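(* Let $\Pi$ be the problem of properly $3$-coloring the nodes of rooted binary trees (without inputs). Then there exists an LCL problem $\Pi'$ on rooted binary trees with the same asymptotic round complexity as $\Pi$ in the LOCAL model, such that every solution of $\Pi'$ is also a solution of $\Pi$, and $\Pi'$ is $O(1)$-mendable.
   Context: In a rooted tree each node knows which neighbor is its parent; in a rooted binary tree each node has at most two children. A proper $3$-coloring assigns to each node a color in $\{1,2,3\}$ with adjacent nodes receiving different colors. A locally verifiable problem on a graph family is given by a set $\Gamma$ of output labels (here no inputs) and a verifier $\psi$ with verification radius $r$: $\psi(G,\lambda,v)\in\{\text{happy},\text{unhappy}\}$ depends only on the radius-$r$ neighborhood of $v$ (structure and outputs, up to isomorphism), and $\lambda$ is a solution if $\psi$ is happy everywhere; it is an LCL problem if $\Gamma$ is finite and degrees are bounded. Partial labelings are maps $\lambda:V\to\Gamma\cup\{\bot\}$; the relaxed verifier $\psi^*$ is happy at $v$ if some node within distance $r$ of $v$ has label $\bot$, and otherwise $\psi^*(G,\lambda,v)=\psi(G,\lambda',v)$ for any completion $\lambda'$ agreeing with $\lambda$ on the radius-$r$ neighborhood of $v$; $\psi^*$ accepts $\lambda$ if happy everywhere. Given $\lambda$ accepted by $\psi^*$ and node $v$, a $t$-mend of $\lambda$ at $v$ is a partial labeling $\mu$ accepted by $\psi^*$ with $\mu(v)\neq\bot$, $\mu(u)=\bot\Rightarrow\lambda(u)=\bot$, and $\mu(u)\neq\lambda(u)\Rightarrow \mathrm{dist}(u,v)\le t$. $\Pi'$ is $O(1)$-mendable if for some $r$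 there is a radius-$r$ verifier for $\Pi'$ (accepting exactly its solutions) and a constant $t$ such that on every graph of the family, for every partial labeling accepted by $\psi^*$ and every node $v$, a $t$-mend at $v$ exists. LOCAL model: nodes with unique identifiers communicate along edges in synchronous rounds with unbounded messages; round complexity is the number of rounds needed to output a valid solution. *)

(* Defs.v *)
From mathcomp Require Import all_boot.

(* par v = Some u : u is the parent of v;  par v = None : v is the root. *)
Definition is_rbt (V : finType) (par : V -> option V) : Prop :=
  (exists r, par r = None /\ forall r', par r' = None -> r' = r) /\
  (forall v, exists k, iter k (fun o => obind par o) (Some v) = None) /\
  (forall v, #|[set u | par u == Some v]| <= 2).

Record rbt := RBT { rV : finType; rpar : rV -> option rV; rpar_ok : is_rbt rV rpar }.

Definition adj (G : rbt) (u w : rV G) : bool :=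
  (rpar G u == Some w) || (rpar G w == Some u).

Fixpoint ball (G : rbt) (k : nat) (v : rV G) : {set rV G} :=
  match k with
  | 0 => [set v]
  | k'.+1 => ball G k' v :|: [set w | [exists u in ball G k' v, adj G u w]]
  end.

Definition local_iso (D : eqType) (r : nat)
  (G1 : rbt) (d1 : rV G1 -> D) (v1 : rV G1)
  (G2 : rbt) (d2 : rV G2 -> D) (v2 : rV G2) : Prop :=
  exists f : rV G1 -> rV G2,
    [/\ f v1 = v2,
        {in ball G1 r v1 &, injective f},
        f @: ball G1 r v1 = ball G2 r v2,
        {in ball G1 r v1 &, forall x y,
            (rpar G1 x == Some y) = (rpar G2 (f x) == Some (f y))}
      & {in ball G1 r v1, forall x, d2 (f x) = d1 x}].

Definition problem (Gam : Type) := forall G : rbt, (rV G -> Gam) -> Prop.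

Definition color := 'I_3.

Definition three_coloring : problem color :=
  fun G col => forall u w : rV G, rpar G u = Some w -> col u != col w.

Definition verifier (Gam : Type) := forall G : rbt, (rV G -> Gam) -> rV G -> bool.

Definition local_verifier (Gam : eqType) (r : nat) (psi : verifier Gam) : Prop :=
  forall G1 G2 (l1 : rV G1 -> Gam) (l2 : rV G2 -> Gam) v1 v2,
    local_iso Gam r G1 l1 v1 G2 l2 v2 -> psi G1 l1 v1 = psi G2 l2 v2.

Definition verifier_for (Gam : eqType) (P : problem Gam) (r : nat) (psi : verifier Gam) :=
  local_verifier Gam r psi /\ forall G (l : rV G -> Gam), P G l <-> forall v, psi G l v.

Definition is_LCL (Gam : finType) (P : problem Gam) : Prop :=
  exists r psi, verifier_for Gam P r psi.

Definition psi_star (Gam : eqType) (r : nat) (psi : verifier Gam)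
  (G : rbt) (mu : rV G -> option Gam) (v : rV G) : Prop :=
  (exists2 u, u \in ball G r v & mu u = None) \/
  (forall l' : rV G -> Gam, (forall u, u \in ball G r v -> mu u = Some (l' u)) -> psi G l' v).

Definition accepted (Gam : eqType) r (psi : verifier Gam) G (mu : rV G -> option Gam) :=
  forall v, psi_star Gam r psi G mu v.

Definition is_mend (Gam : eqType) r (psi : verifier Gam) (t : nat) G
  (lam : rV G -> option Gam) (v : rV G) (mu : rV G -> option Gam) : Prop :=
  [/\ accepted Gam r psi G mu,
      mu v != None,
      forall u, mu u = None -> lam u = None
    & forall u, mu u != lam u -> u \in ball G t v].

Definition O1_mendable (Gam : eqType) (P : problem Gam) : Prop :=
  exists r psi t, verifier_for Gam P r psi /\
    forall G (lam : rV G -> option Gam), accepted Gam r psi G lam ->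
      forall v, exists mu, is_mend Gam r psi t G lam v mu.

(* unique identifiers from {1, ..., n^c}; nodes know n *)
Definition ids_ok (c : nat) (G : rbt) (id : rV G -> nat) : Prop :=
  injective id /\ forall v, 1 <= id v <= #|rV G| ^ c.

Definition algorithm (Gam : Type) := forall G : rbt, (rV G -> nat) -> rV G -> Gam.

(* A t-round algorithm on n-node graphs: the output of a node depends only
   on its radius-t neighbourhood (structure and identifiers) *)
Definition local_alg (Gam : Type) (c n t : nat) (A : algorithm Gam) : Prop :=
  forall G1 G2 (id1 : rV G1 -> nat) (id2 : rV G2 -> nat) v1 v2,
    #|rV G1| = n -> #|rV G2| = n -> ids_ok c G1 id1 -> ids_ok c G2 id2 ->
    local_iso nat t G1 id1 v1 G2 id2 v2 -> A G1 id1 v1 = A G2 id2 v2.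

Definition solvable_at (Gam : Type) (c : nat) (P : problem Gam) (n t : nat) : Prop :=
  exists A : algorithm Gam, local_alg Gam c n t A /\
    forall G (id : rV G -> nat), #|rV G| = n -> ids_ok c G id -> P G (A G id).

(* Theta-equality of the (minimal) round complexities as functions of n *)
Definition same_asymptotic_complexity (Gam1 Gam2 : Type) (c : nat)
  (P1 : problem Gam1) (P2 : problem Gam2) : Prop :=
  exists C n0, forall n t, n0 <= n ->
    (solvable_at Gam1 c P1 n t -> solvable_at Gam2 c P2 n (C * t)) /\
    (solvable_at Gam2 c P2 n t -> solvable_at Gam1 c P1 n (C * t)).

(* Main.v *)
(* Call a node flexible if all its grandchildren have the same color: then it can
   be given any color by recoloring only its children.  Solutions of the
   restricted problem are the proper 3-colorings in which every node is flexible
   or has only flexible children.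

   Pushing a proper 3-coloring down two generations makes all nodes flexible, so
   two extra rounds suffice; no extra round is available if 3-coloring itself
   takes 0 rounds, which is impossible for n >= 4 by pigeonhole on a path.

   To mend a hole v, start from the fourth ancestor of v, keeping it and its
   children (or from the root, keeping nothing), and color the next levels by
   depth until all nodes that see v are passed.  The last such level is glued
   to the old coloring underneath: each of its nodes is made flexible with a color
   of grandchildren chosen for that node alone, and the old coloring is resumed at
   the first flexible descendants, which are at bounded distance. *)

Require Import Defs.
From mathcomp Require Import all_boot.
From mathcomp Require Import fingroup perm zify.

Set Implicit Arguments.
Unset Strict Implicit.
Unset Printing Implicit Defensive.

(** * Ancestors, depth and balls in a rooted tree *)

Section Ancestors.
Variable G : rbt.
Implicit Types (u v w x y : rV G).

Definition anc k x : option (rV G) := iter k (obind (rpar G)) (Some x).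

Lemma ancS k x y : rpar G x = Some y -> anc k.+1 x = anc k y.
Proof. by move=> xy; rewrite /anc iterSr /= xy. Qed.

Lemma anc_root k x : rpar G x = None -> anc k.+1 x = None.
Proof. by move=> x0; rewrite /anc iterSr /= x0; elim: k => //= k ->. Qed.

Lemma anc_add j k x y : anc j x = Some y -> anc (k + j) x = anc k y.
Proof. by move=> xy; rewrite /anc iterD -/(anc j x) xy. Qed.

Lemma anc2 x y z : rpar G x = Some y -> rpar G y = Some z -> anc 2 x = Some z.
Proof. by move=> xy yz; rewrite (ancS _ xy) (ancS _ yz). Qed.

Lemma anc2P x z :
  reflect (exists2 y, rpar G x = Some y & rpar G y = Some z) (anc 2 x == Some z).
Proof.
apply: (iffP eqP) => [|[y xy yz]]; last exact: anc2 xy yz.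
by rewrite /anc /=; case xy: (rpar G x) => [y|] //= yz; exists y.
Qed.

Lemma anc_eventually_None x : exists k, anc k.+1 x == None.
Proof.
have [_ [/(_ x) [k kx] _]] := rpar_ok G.
by exists k; rewrite /anc iterS kx.
Qed.

Definition depth x := ex_minn (anc_eventually_None x).

Lemma depth_par x y : rpar G x = Some y -> depth x = (depth y).+1.
Proof.
move=> xy; rewrite /depth; case: ex_minnP => m /eqP mx minx.
case: ex_minnP => n /eqP ny miny; apply/eqP; rewrite eqn_leq; apply/andP; split.
  by apply: minx; rewrite (ancS _ xy) ny.
case: m mx minx => [|m] mx minx; first by rewrite (ancS _ xy) in mx.
by rewrite ltnS; apply: miny; rewrite -(ancS _ xy) mx.
Qed.

Lemma depth_root x : rpar G x = None -> depth x = 0.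
Proof.
move=> x0; rewrite /depth; case: ex_minnP => m _ /(_ 0).
by rewrite /anc /= x0 leqn0 eqxx => /(_ isT) /eqP.
Qed.

Lemma depth_anc k x y : anc k x = Some y -> depth x = depth y + k.
Proof.
elim: k x => [|k IH] x; first by case=> ->; rewrite addn0.
case px: (rpar G x) => [z|]; last by rewrite anc_root.
by rewrite (ancS _ px) (depth_par px) addnS => /IH ->.
Qed.

Lemma anc_depth x k : k <= depth x -> exists y, anc k x = Some y.
Proof.
elim: k => [|k IH] kx; first by exists x.
have [y xy] := IH (ltnW kx).
case py: (rpar G y) => [z|]; last first.
  by move: kx; rewrite (depth_anc xy) (depth_root py) add0n ltnn.
by exists z; rewrite /anc iterS -/(anc k x) xy /= py.
Qed.

Lemma kids_le2 x : #|[set u | rpar G u == Some x]| <= 2.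
Proof. by case: (rpar_ok G) => _ []. Qed.

Lemma ballS k x y z : y \in ball G k x -> adj G y z -> z \in ball G k.+1 x.
Proof.
move=> yx yz; rewrite /= inE; apply/orP; right; rewrite inE.
by apply/existsP; exists y; rewrite yx.
Qed.

Lemma ballSP k x z :
  z \in ball G k.+1 x -> z \in ball G k x \/ exists2 y, y \in ball G k x & adj G y z.
Proof.
rewrite /= inE => /orP [|]; first by left.
by rewrite inE => /existsP [y /andP [yx yz]]; right; exists y.
Qed.

Lemma ball_leq j k x : j <= k -> {subset ball G j x <= ball G k x}.
Proof.
move=> jk y yx; rewrite -(subnK jk); elim: (k - j) => //= i IH.
by rewrite inE IH.
Qed.

Lemma ball_center k x : x \in ball G k x.
Proof. by apply: (ball_leq (leq0n k)); rewrite /= inE. Qed.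

Lemma ball_trans j k x y z :
  y \in ball G j x -> z \in ball G k y -> z \in ball G (j + k) x.
Proof.
move=> yx; elim: k z => [|k IH] z; first by rewrite /= inE addn0 => /eqP ->.
move=> /ballSP [/IH|[w /IH wx wz]]; last by rewrite addnS; exact: ballS wz.
by apply: ball_leq; rewrite leq_add2l.
Qed.

Lemma adj_par x y : rpar G x = Some y -> adj G x y.
Proof. by rewrite /adj => ->; rewrite eqxx. Qed.

Lemma adj_kid x y : rpar G x = Some y -> adj G y x.
Proof. by rewrite /adj => ->; rewrite eqxx orbT. Qed.

Lemma ball_par k x y z : y \in ball G k x -> rpar G y = Some z -> z \in ball G k.+1 x.
Proof. by move=> yx /adj_par; exact: ballS. Qed.

Lemma ball_kid k x y z : y \in ball G k x -> rpar G z = Some y -> z \in ball G k.+1 x.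
Proof. by move=> yx /adj_kid; exact: ballS. Qed.

Lemma anc_ball k x y : anc k x = Some y -> y \in ball G k x /\ x \in ball G k y.
Proof.
elim: k y => [|k IH] y; first by case=> ->; rewrite !ball_center.
rewrite /anc iterS -/(anc k x); case E: (anc k x) => [z|] //= zy.
have [zx xz] := IH _ E; split; first exact: ball_par zx zy.
by apply: (@ball_trans 1 k _ z) => //; apply: ball_kid zy; rewrite ball_center.
Qed.

(** A walk can be straightened to go up to a common ancestor and then down: a step to the parent
    cancels the last step down, or raises the meeting node if there is none. *)
Lemma ball_anc k x y :
  y \in ball G k x -> exists z i j, [/\ i + j <= k, anc i x = Some z & anc j y = Some z].
Proof.
elim: k y => [|k IH] y; first by rewrite /= inE => /eqP ->; exists x, 0, 0.
move=> /ballSP [/IH [z [i [j [ijk iz jz]]]]|]; first by exists z, i, j; split=> //; lia.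
move=> [w /IH [z [i [j [ijk iz jz]]]]] /orP [/eqP wy|/eqP yw].
  case: j ijk jz => [|j] ijk jz.
    exists y, i.+1, 0; split=> //.
    by rewrite /anc iterS -/(anc i x) iz; case: jz => <-.
  by exists z, i, j; split=> //; [lia | rewrite -(ancS _ wy)].
by exists z, i, j.+1; split=> //; [lia | rewrite (ancS _ yw)].
Qed.

End Ancestors.

(** * Restriction of local isomorphisms to smaller balls *)

Section LocalIso.
Variables (D : eqType) (r : nat) (G1 G2 : rbt) (d1 : rV G1 -> D) (d2 : rV G2 -> D).
Variables (v1 : rV G1) (v2 : rV G2) (f : rV G1 -> rV G2).
Hypothesis f_v : f v1 = v2.
Hypothesis f_inj : {in ball G1 r v1 &, injective f}.
Hypothesis f_ball : f @: ball G1 r v1 = ball G2 r v2.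
Hypothesis f_par : {in ball G1 r v1 &, forall x y,
  (rpar G1 x == Some y) = (rpar G2 (f x) == Some (f y))}.
Hypothesis f_dec : {in ball G1 r v1, forall x, d2 (f x) = d1 x}.

Lemma iso_adj : {in ball G1 r v1 &, forall x y, adj G1 x y = adj G2 (f x) (f y)}.
Proof. by move=> x y xr yr; rewrite /adj !f_par. Qed.

Lemma iso_into j k u x : j + k <= r -> u \in ball G1 j v1 ->
  x \in ball G1 k u -> f x \in ball G2 k (f u).
Proof.
move=> jkr uj; elim: k jkr x => [|k IH] jkr x; first by rewrite /= !inE => /eqP ->.
have kr : j + k <= r by lia.
have inr y i : i <= k.+1 -> y \in ball G1 i u -> y \in ball G1 r v1.
  by move=> ik /(ball_trans uj); apply: ball_leq; lia.
move=> xk; have xr := inr _ _ (leqnn _) xk.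
case/ballSP: xk => [/(IH kr)|[y yk yx]]; first by apply: ball_leq.
by apply: (ballS (IH kr _ yk)); rewrite -iso_adj // (inr _ _ (leqnSn k) yk).
Qed.

Lemma iso_onto j k u y : j + k <= r -> u \in ball G1 j v1 ->
  y \in ball G2 k (f u) -> exists2 x, x \in ball G1 k u & f x = y.
Proof.
move=> jkr uj; elim: k jkr y => [|k IH] jkr y.
  by rewrite /= inE => /eqP ->; exists u; rewrite ?inE.
have kr : j + k <= r by lia.
case/ballSP=> [/(IH kr) [x xk fx]|[w wk wy]].
  by exists x => //; apply: ball_leq xk.
have [x xk fx] := IH kr _ wk.
have xr : x \in ball G1 r v1 by apply: ball_leq (ball_trans uj xk).
have fuj : f u \in ball G2 j v2.
  by rewrite -f_v; apply: (@iso_into 0); rewrite ?ball_center //; lia.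
have : y \in ball G2 r v2.
  by apply: ball_leq (ball_trans fuj (ballS wk wy)).
rewrite -f_ball => /imsetP [z zr yE]; exists z => //.
by apply: (ballS xk); rewrite iso_adj // fx -yE.
Qed.

Lemma iso_restrict j k u : j + k <= r -> u \in ball G1 j v1 ->
  local_iso D k G1 d1 u G2 d2 (f u).
Proof.
move=> jkr uj; have sub : {subset ball G1 k u <= ball G1 r v1}.
  by move=> x /(ball_trans uj); apply: ball_leq.
exists f; split=> //.
- by move=> x y /sub xr /sub yr; apply: f_inj.
- apply/setP=> y; apply/imsetP/idP => [[x xk ->]|]; first exact: iso_into jkr uj xk.
  by move/(iso_onto jkr uj) => [x xk <-]; exists x.
- by move=> x y /sub xr /sub yr; apply: f_par.
- by move=> x /sub xr; apply: f_dec.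
Qed.

(** Roots match too: a parent of [f x] lifts to a parent of [x]. The strict bound [j < r] leaves
    room for this extra step. *)
Lemma iso_rpar j x : j < r -> x \in ball G1 j v1 ->
  rpar G2 (f x) = omap f (rpar G1 x).
Proof.
move=> jr xj; have xr : x \in ball G1 r v1 by apply: ball_leq xj; exact: ltnW.
case xy: (rpar G1 x) => [y|] /=.
  by apply/eqP; rewrite -f_par ?xy //; apply: ball_leq (ball_par xj xy).
case fxy: (rpar G2 (f x)) => [y|] //.
have y1 : y \in ball G2 1 (f x) by apply: ball_par fxy; apply: ball_center.
have [|z zx fz] := iso_onto _ xj y1; first lia.
have : rpar G1 x == Some z.
  by rewrite f_par ?fxy ?fz //; apply: ball_leq (ball_trans xj zx); lia.
by rewrite xy.
Qed.

Lemma iso_kid j x w : j < r -> x \in ball G1 j v1 ->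
  rpar G1 w = Some x -> rpar G2 (f w) = Some (f x).
Proof.
move=> jr xj wx; apply/eqP; rewrite -f_par ?wx //.
  by apply: ball_leq (ball_kid xj wx).
by apply: ball_leq xj; lia.
Qed.

Lemma iso_kid_onto j x w : j < r -> x \in ball G1 j v1 ->
  rpar G2 w = Some (f x) -> exists2 z, rpar G1 z = Some x & f z = w.
Proof.
move=> jr xj wx; have w1 : w \in ball G2 1 (f x) by apply: ball_kid wx; apply: ball_center.
have [|z zx fz] := iso_onto _ xj w1; first lia.
exists z => //; apply/eqP; rewrite f_par ?fz ?wx //.
  by apply: ball_leq (ball_trans xj zx); lia.
by apply: ball_leq xj; lia.
Qed.

End LocalIso.

Lemma local_iso_leq (D : eqType) r k (G1 G2 : rbt) (d1 : rV G1 -> D) (d2 : rV G2 -> D) v1 v2 :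
  k <= r -> local_iso D r G1 d1 v1 G2 d2 v2 -> local_iso D k G1 d1 v1 G2 d2 v2.
Proof.
move=> kr [f [fv fi fb fp fd]]; rewrite -fv.
by apply: (@iso_restrict D r G1 G2 d1 d2 v1 v2 f _ _ _ _ _ 0) => //; rewrite ball_center.
Qed.

(** * The verifier of the restricted problem and its locality *)

Section Verifier.
Variable T : eqType.
Variable G : rbt.
Variable m : rV G -> T.

(** [T] is general because the same test is run on total colorings and on partial ones with values
    in [option color]. *)
Definition flexible x : bool :=
  [forall w, forall w', (anc 2 w == Some x) ==> (anc 2 w' == Some x) ==> (m w == m w')].

Definition kids_flexible x : bool := [forall q, (rpar G q == Some x) ==> flexible q].

Definition proper_at x : bool := [forall w, (rpar G w == Some x) ==> (m x != m w)].

Definition flex_verifier x : bool := proper_at x && (flexible x || kids_flexible x).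

Lemma flexibleP x :
  reflect (forall w w', anc 2 w = Some x -> anc 2 w' = Some x -> m w = m w') (flexible x).
Proof.
apply: (iffP idP) => [/forallP H w w' wx wx'|H].
  by move/forallP: (H w) => /(_ w'); rewrite wx wx' eqxx => /eqP.
apply/forallP=> w; apply/forallP=> w'.
by apply/implyP=> /eqP wx; apply/implyP=> /eqP wx'; rewrite (H w w').
Qed.

Lemma kids_flexibleP x :
  reflect (forall q, rpar G q = Some x -> flexible q) (kids_flexible x).
Proof.
by apply: (iffP forallP) => H q; [move/eqP; apply/implyP | apply/implyP=> /eqP; apply: H].
Qed.

Lemma proper_atP x :
  reflect (forall w, rpar G w = Some x -> m x != m w) (proper_at x).
Proof.
by apply: (iffP forallP) => H q; [move/eqP; apply/implyP | apply/implyP=> /eqP; apply: H].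
Qed.

End Verifier.

Lemma flexible_iso (D : eqType) r (G1 G2 : rbt) (d1 : rV G1 -> D) (d2 : rV G2 -> D) v1 v2 :
  1 < r -> local_iso D r G1 d1 v1 G2 d2 v2 -> flexible d1 v1 = flexible d2 v2.
Proof.
move=> r2 [f [fv fi fb fp fd]].
have c0 : v1 \in ball G1 0 v1 by apply: ball_center.
have g1 w : anc 2 w = Some v1 -> anc 2 (f w) = Some v2 /\ d2 (f w) = d1 w.
  move=> wv; have [wr _] : w \in ball G1 2 v1 /\ true by have [] := anc_ball wv.
  split; last by rewrite fd //; apply: ball_leq wr.
  case/eqP/anc2P: wv => y wy yv; apply: anc2 (_ : _ = Some (f y)) _.
    by apply: (iso_kid fp (j := 1)) => //; apply: ball_kid c0 yv.
  by rewrite -fv; apply: (iso_kid fp (j := 0)) => //; lia.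
have g2 w : anc 2 w = Some v2 -> exists2 z, anc 2 z = Some v1 & f z = w.
  case/eqP/anc2P => y wy; rewrite -fv => yv.
  have [y1 y1v fy] : exists2 z, rpar G1 z = Some v1 & f z = y.
    by apply: (iso_kid_onto fv fb fp (j := 0)) => //; lia.
  have [z zy fz] : exists2 z, rpar G1 z = Some y1 & f z = w.
    by apply: (iso_kid_onto fv fb fp (j := 1)); rewrite ?fy //; apply: ball_kid c0 y1v.
  by exists z => //; apply: anc2 zy y1v.
apply/flexibleP/flexibleP => H w w'.
  by move=> /g2 [z zv <-] /g2 [z' zv' <-]; rewrite (g1 _ zv).2 (g1 _ zv').2; apply: H.
by move=> /g1 [wv <-] /g1 [wv' <-]; apply: H.
Qed.

(** Radius 3 is one step to a child and two more to the grandchildren that decide its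
    flexibility. *)
Lemma flex_verifier_iso (D : eqType) (G1 G2 : rbt) (d1 : rV G1 -> D) (d2 : rV G2 -> D) v1 v2 :
  local_iso D 3 G1 d1 v1 G2 d2 v2 -> flex_verifier d1 v1 = flex_verifier d2 v2.
Proof.
move=> iso; rewrite /flex_verifier (flexible_iso _ iso) //.
case: iso => f [fv fi fb fp fd].
have c0 : v1 \in ball G1 0 v1 by apply: ball_center.
have kidr w : rpar G1 w = Some v1 -> w \in ball G1 1 v1 by apply: ball_kid.
have kid w : rpar G1 w = Some v1 -> rpar G2 (f w) = Some v2.
  by move=> wv; rewrite -fv; apply: (iso_kid fp (j := 0)).
have kid_onto w : rpar G2 w = Some v2 -> exists2 z, rpar G1 z = Some v1 & f z = w.
  by rewrite -fv; apply: (iso_kid_onto fv fb fp (j := 0)).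
have kid_dec w : rpar G1 w = Some v1 -> d2 (f w) = d1 w.
  by move=> /kidr wv; rewrite fd //; apply: ball_leq wv.
have kid_flex w : rpar G1 w = Some v1 -> flexible d1 w = flexible d2 (f w).
  move=> /kidr wv; apply: (@flexible_iso _ 2) => //.
  by apply: (iso_restrict fv fi fb fp fd (j := 1)).
have dv : d2 v2 = d1 v1 by rewrite -fv fd ?ball_center.
congr (_ && (_ || _)).
  apply/proper_atP/proper_atP => H w.
    by move=> /kid_onto [z zv <-]; rewrite kid_dec // dv; apply: H.
  by move=> wv; rewrite -dv -kid_dec //; apply: H; apply: kid.
apply/kids_flexibleP/kids_flexibleP => H w.
  by move=> /kid_onto [z zv <-]; rewrite -kid_flex //; apply: H.
by move=> wv; rewrite kid_flex //; apply: H; apply: kid.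
Qed.

Lemma local_iso_eq_in (D : eqType) r (G : rbt) (d1 d2 : rV G -> D) v :
  {in ball G r v, d1 =1 d2} -> local_iso D r G d1 v G d2 v.
Proof.
move=> d12; exists id; split=> //; last by move=> x /d12.
by apply/setP=> x; apply/imsetP/idP => [[y yr ->]|xr] //; exists x.
Qed.

Lemma flex_verifier_Some (T : eqType) (G : rbt) (m : rV G -> T) v :
  flex_verifier (fun x => Some (m x)) v = flex_verifier m v.
Proof. by []. Qed.

Lemma flex_verifier_eq_in (T : eqType) (G : rbt) (mu : rV G -> option T) (l : rV G -> T) v :
  (forall u, u \in ball G 3 v -> mu u = Some (l u)) ->
  flex_verifier mu v = flex_verifier l v.
Proof.
move=> mul; rewrite -(flex_verifier_Some l); apply: flex_verifier_iso.
by apply: local_iso_eq_in => u /mul.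
Qed.

Definition flex_coloring : problem color := fun G l => forall v, flex_verifier l v.
Arguments flex_coloring : clear implicits.

Lemma flex_coloring_verifier_for :
  verifier_for color flex_coloring 3 (fun G l v => flex_verifier l v).
Proof.
split=> [G1 G2 l1 l2 v1 v2 iso|G l]; last by split.
exact (flex_verifier_iso iso).
Qed.

Lemma flex_coloring_proper G l : flex_coloring G l -> three_coloring G l.
Proof.
move=> H u w uw; have /andP [/proper_atP /(_ u uw)] := H w.
by rewrite eq_sym.
Qed.

Section Accepted.
Variables (G : rbt) (mu : rV G -> option color).

(** Completions are avoided: without a hole within distance 3, the verifier gives the same answer on
    [mu] itself. *)
Lemma flex_accepted :
  accepted color 3 (fun G l v => flex_verifier l v) G mu <->
  forall u, (exists2 w, w \in ball G 3 u & mu w = None) \/ flex_verifier mu u.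
Proof.
split=> H u.
  case: (boolP [exists w in ball G 3 u, mu w == None]) => [/existsP [w /andP [wu /eqP w0]]|].
    by left; exists w.
  move=> /existsPn nex; case: (H u) => [|Hu]; first by left.
  have mul w : w \in ball G 3 u -> mu w = Some (odflt ord0 (mu w)).
    by move=> wu; have := nex w; rewrite wu; case: (mu w).
  by right; rewrite (flex_verifier_eq_in mul); apply: Hu.
case: (H u) => [|Hu]; [by left | right=> l mul].
by rewrite -(flex_verifier_eq_in mul).
Qed.

End Accepted.

(** * Comparison of round complexities *)

Lemma solvable_at_leq (Gam : Type) c (P : problem Gam) n t t' :
  t <= t' -> solvable_at Gam c P n t -> solvable_at Gam c P n t'.
Proof.
move=> tt' [A [locA solA]]; exists A; split=> // G1 G2 id1 id2 v1 v2 n1 n2 ok1 ok2 iso.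
exact: locA (local_iso_leq tt' iso).
Qed.

Definition next_color (a : color) : color := ordS a.

Lemma next_color_neq a : next_color a != a.
Proof. by case: a => [[|[|[|]]]]. Qed.

(* Colors are pushed down two generations; the root's missing father and
   grandfather act as if colored [next_color (c root)] and [c root]. *)
Definition push_down2 (G : rbt) (l : rV G -> color) (v : rV G) : color :=
  match rpar G v with
  | None => l v
  | Some p => if rpar G p is Some q then l q else next_color (l p)
  end.

(** An edge takes over the colors of the edge two generations higher (virtual above the root), so it
    stays proper. All grandchildren of [x] receive the old color of [x]. *)
Lemma push_down2_flex G (l : rV G -> color) :
  three_coloring G l -> flex_coloring G (push_down2 l).
Proof.
move=> l3 x; apply/andP; split.
  apply/proper_atP=> w wx; rewrite /push_down2 wx.
  case px: (rpar G x) => [p|]; last by rewrite eq_sym next_color_neq.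
  case pp: (rpar G p) => [q|]; last by rewrite next_color_neq.
  by rewrite eq_sym; apply: l3.
apply/orP; left; apply/flexibleP=> w w'.
by move=> /eqP/anc2P [y wy yx] /eqP/anc2P [y' wy' yx']; rewrite /push_down2 wy yx wy' yx'.
Qed.

Lemma push_down2_solvable c n t :
  solvable_at color c three_coloring n t -> solvable_at color c flex_coloring n (t + 2).
Proof.
move=> [A [locA solA]]; exists (fun G id => push_down2 (A G id)); split; last first.
  by move=> G id nG idG; apply: push_down2_flex; apply: solA.
move=> G1 G2 id1 id2 v1 v2 n1 n2 ok1 ok2 [f [fv fi fb fp fd]].
have c0 : v1 \in ball G1 0 v1 by apply: ball_center.
(* [A] is queried only at [v1] and its ancestors within distance 2, whose radius-[t] balls lie in
   the known ball of radius [t + 2]. *)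
have eqA j u : j <= 2 -> u \in ball G1 j v1 -> A G1 id1 u = A G2 id2 (f u).
  move=> j2 uj; apply: locA => //.
  by apply: (iso_restrict fv fi fb fp fd (j := j)) => //; rewrite addnC leq_add2l.
rewrite /push_down2 -fv (iso_rpar fv fb fp (j := 0)) ?addn2 //.
case vp: (rpar G1 v1) => [p|] /=; last exact: (eqA 0).
have p1 : p \in ball G1 1 v1 by apply: ball_par c0 vp.
rewrite (iso_rpar fv fb fp (j := 1)) ?addn2 //.
case pq: (rpar G1 p) => [q|] /=; last by rewrite (eqA 1).
by rewrite (eqA 2) //; apply: ball_par p1 pq.
Qed.

(** * Impossibility of 3-coloring in zero rounds *)

Section Path.
Variable n : nat.

Definition path_par (i : 'I_n.+1) : option 'I_n.+1 :=
  if i == ord0 then None else Some (inord i.-1).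

Lemma path_is_rbt : is_rbt 'I_n.+1 path_par.
Proof.
split; first by exists ord0; split=> // i; rewrite /path_par; case: eqP.
have pp (i j : 'I_n.+1) : path_par i = Some j -> nat_of_ord i = j.+1.
  rewrite /path_par; case: eqP => // /eqP i0 [<-].
  have : 0 < i by rewrite lt0n; apply: contra i0 => /eqP i0; apply/eqP/val_inj.
  by move=> i_gt0; rewrite inordK prednK //; apply: ltnW.
split=> i.
  exists i.+1; have [k ik] := ubnP (nat_of_ord i); elim: k i ik => // k IH i ik.
  rewrite iterSr /=; case E: (path_par i) => [j|]; last by elim: (nat_of_ord i) => //= ? ->.
  by rewrite (pp _ _ E); apply: IH; rewrite -ltnS -(pp _ _ E).
apply: (@leq_trans 1) => //; apply/card_le1_eqP => j k.
rewrite !inE => /eqP /pp ji /eqP /pp ki; apply: val_inj; by rewrite /= ji ki.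
Qed.

Definition path_rbt := @RBT _ _ path_is_rbt.

End Path.

(** A zero-round output depends on the node's own identifier alone. Among four or more identifiers
    two share a color, and these can be placed on adjacent nodes. *)
Lemma no_zero_round_coloring c n :
  1 <= c -> 4 <= n -> ~ solvable_at color c three_coloring n 0.
Proof.
move=> c1; case: n => [|[|n]] // n4 [A [locA solA]].
pose G := path_rbt n.+1.
pose id (s : {perm 'I_n.+2}) (i : rV G) := (s i).+1.
have cardG : #|rV G| = n.+2 by rewrite card_ord.
have idok s : ids_ok c G (id s).
  split=> [i j [/val_inj/perm_inj]|i] //.
  rewrite cardG /=; apply: leq_trans (ltn_ord (s i)) _.
  by rewrite -{1}(expn1 n.+2) leq_exp2l.
pose g := fun i : 'I_n.+2 => A G (id 1%g) i.
(* A ball of radius 0 is a single node without edges, so a constant map is a local isomorphism. *)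
have gA s i : A G (id s) i = g (s i).
  apply: locA => //; exists (fun=> s i); split=> //=.
  - by move=> x y; rewrite !inE => /eqP -> /eqP ->.
  - apply/setP=> x; apply/imsetP/idP => [[y _ ->]|]; rewrite inE // => /eqP ->.
    by exists i; rewrite ?inE.
  - move=> x y; rewrite !inE => /eqP -> /eqP ->.
    have nopar (z : rV G) : (rpar G z == Some z) = false.
      by apply/negP=> /eqP/depth_par; lia.
    by rewrite !nopar.
  - by move=> x; rewrite inE => /eqP ->; rewrite /id perm1.
have /injectivePn [i [j ij gij]] : ~~ injectiveb g.
  apply/negP=> /injectiveP /leq_card; rewrite !card_ord; lia.
pose one : 'I_n.+2 := inord 1.
(* [s] is to send 0 to [i] and its child 1 to [j]: its first factor moves 1 to the preimage [k] of
   [j] under the second one, and fixes 0 since [k] is not 0. *)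
pose k := tperm ord0 i j.
pose s := (tperm one k * tperm ord0 i)%g.
have one0 : one != ord0 by rewrite -val_eqE /= inordK.
have k0 : k != ord0.
  apply: contra ij => /eqP k0; apply/eqP.
  by rewrite -[RHS](tpermK ord0 i) -/k k0 tpermL.
have s0 : s ord0 = i by rewrite permM (tpermD one0 k0) tpermL.
have s1 : s one = j by rewrite permM tpermL tpermK.
have par1 : rpar G one = Some ord0.
  by rewrite /= /path_par (negbTE one0); congr (Some _); apply: val_inj; rewrite /= !inordK.
by have := solA G (id s) cardG (idok s) one ord0 par1; rewrite !gA s0 s1 gij eqxx.
Qed.

Lemma flex_coloring_complexity c :
  1 <= c -> same_asymptotic_complexity color color c three_coloring flex_coloring.
Proof.
(* [t + 2 <= 3 * t] once [t > 0], and [t = 0] is impossible from 4 nodes on. *)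
move=> c1; exists 3, 4 => n t n4; split=> [|[A [locA solA]]].
  case: t => [/no_zero_round_coloring|t /push_down2_solvable]; first by case.
  by apply: solvable_at_leq; lia.
apply: (@solvable_at_leq _ _ _ _ t); first lia.
by exists A; split=> // G id nG idG; apply: flex_coloring_proper; apply: solA.
Qed.

(** * Recoloring the subtree below a node [a] *)

Definition avoid (s : seq color) : color := odflt ord0 [pick c | c \notin s].

Lemma avoidP s : size s <= 2 -> avoid s \notin s.
Proof.
move=> s2; rewrite /avoid; case: pickP => //= all_in.
have : #|color| <= size s.
  apply: leq_trans (card_size s); apply: subset_leq_card.
  by apply/subsetP => c _; have /negbFE := all_in c.
by rewrite card_ord; lia.
Qed.

Lemma avoid1 b c : avoid [:: b; c] != b.
Proof. by have := @avoidP [:: b; c] isT; rewrite !inE negb_or => /andP []. Qed.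

Lemma avoid2 b c : avoid [:: b; c] != c.
Proof. by have := @avoidP [:: b; c] isT; rewrite !inE negb_or => /andP []. Qed.

Section Repair.
Variables (G : rbt) (old : rV G -> color) (a : rV G) (keep : bool).

Definition kids_avoid (h : rV G -> color) x : color :=
  avoid [seq h q | q <- enum [set q | rpar G q == Some x]].

(** Binarity enters here: two children leave one of three colors free. *)
Lemma kids_avoidP h x q : rpar G q = Some x -> kids_avoid h x != h q.
Proof.
move=> qx; have := @avoidP [seq h q | q <- enum [set q | rpar G q == Some x]].
rewrite size_map -cardE kids_le2 => /(_ isT) /mapP nin.
by apply/eqP => E; apply: nin; exists q; rewrite // mem_enum inE qx.
Qed.

(** Meant for flexible [x], whose grandchildren share this color; the default serves nodes without
    grandchildren. *)
Definition grandkid_color x : color := odflt ord0 (omap old [pick w | anc 2 w == Some x]).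

Lemma grandkid_colorP x w : flexible old x -> anc 2 w = Some x -> grandkid_color x = old w.
Proof.
move=> /flexibleP flx wx; rewrite /grandkid_color.
case: pickP => [w' /eqP w'x|/(_ w)]; last by rewrite wx eqxx.
exact: flx.
Qed.

(** Level 2 gets this color, so it must differ from the kept colors of the children of [a]. *)
Definition even_color : color := kids_avoid old a.
Definition odd_color : color := next_color even_color.
Definition target x : color := kids_avoid grandkid_color x.

(* [k] is the depth of [x] below [a].  All grandkids of a node [s] at depth 7 get
   [target s], which makes [s] flexible while [target s] is compatible with the
   unchanged grandkids of the flexible kids of [s].  Below, the old coloring is
   resumed at the first flexible node; it is also resumed under nodes at which
   neither alternative of the old verifier holds, since only nodes that the old
   coloring satisfies have to be satisfied there. *)
Definition repair_at k x : color :=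
  let p i := odflt x (anc i x) in
  match k with
  | 0 | 1 => if keep then old x else if odd k then odd_color else even_color
  | 2 | 4 | 6 => even_color
  | 3 | 5 | 7 => odd_color
  | 8 => avoid [:: odd_color; target (p 1)]
  | 9 => target (p 2)
  | 10 => if flexible old (p 2) || ~~ (flexible old (p 1) || kids_flexible old (p 1))
          then old x else avoid [:: target (p 3); grandkid_color (p 1)]
  | 11 => if flexible old (p 3) || flexible old (p 2) || ~~ kids_flexible old (p 2)
          then old x
          else avoid [:: avoid [:: target (p 4); grandkid_color (p 2)]; grandkid_color (p 1)]
  | _ => old x
  end.

(** If [a] is an ancestor of [x], its distance is the difference of depths, so one test decides. *)
Definition repair x : color :=
  let k := depth x - depth a in if anc k x == Some a then repair_at k x else old x.

Lemma repair_below k x : anc k x = Some a -> repair x = repair_at k x.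
Proof. by move=> xa; rewrite /repair (depth_anc xa) addKn xa eqxx. Qed.

Lemma repair_outside x : (forall k, anc k x <> Some a) -> repair x = old x.
Proof. by move=> xa; rewrite /repair; case: eqP => // /xa. Qed.

Lemma repair_deep k x : anc k x = Some a -> 11 < k -> repair x = old x.
Proof. by move=> /repair_below ->; rewrite /repair_at; do 12?[case: k => [|k] //]. Qed.

Lemma repair_top k x : anc k x = Some a -> ~~ keep || (1 < k) -> k <= 7 ->
  repair x = if odd k then odd_color else even_color.
Proof.
move=> /repair_below ->; rewrite /repair_at.
by do 8?[case: k => [|k] //]; move=> /orP [/negbTE ->|].
Qed.

Lemma repair_keep k x : anc k x = Some a -> keep -> k <= 1 -> repair x = old x.
Proof. by move=> /repair_below ->; rewrite /repair_at => ->; case: k => [|[|]]. Qed.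

Lemma repair8 s q : anc 7 s = Some a -> rpar G q = Some s ->
  repair q = avoid [:: odd_color; target s].
Proof. by move=> sa qs; rewrite (@repair_below 8) /repair_at ?(ancS _ qs). Qed.

Lemma repair9 s z : anc 7 s = Some a -> anc 2 z = Some s -> repair z = target s.
Proof. by move=> sa zs; rewrite (@repair_below 9) /repair_at ?zs // (anc_add 7 zs). Qed.

Lemma repair10 s q z y : anc 7 s = Some a ->
    rpar G q = Some s -> rpar G z = Some q -> rpar G y = Some z ->
  repair y = if flexible old q || ~~ (flexible old z || kids_flexible old z)
             then old y else avoid [:: target s; grandkid_color z].
Proof.
move=> sa qs zq yz.
by rewrite (@repair_below 10) /repair_at ?(ancS _ yz, ancS _ zq, ancS _ qs).
Qed.

Lemma repair11 s q z y x : anc 7 s = Some a ->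
    rpar G q = Some s -> rpar G z = Some q -> rpar G y = Some z -> rpar G x = Some y ->
  repair x = if flexible old q || flexible old z || ~~ kids_flexible old z then old x
    else avoid [:: avoid [:: target s; grandkid_color z]; grandkid_color y].
Proof.
move=> sa qs zq yz xy; rewrite (@repair_below 11) /repair_at.
  by rewrite ?(ancS _ xy, ancS _ yz, ancS _ zq, ancS _ qs).
by rewrite ?(ancS _ xy, ancS _ yz, ancS _ zq, ancS _ qs).
Qed.

Lemma even_odd_color : even_color != odd_color.
Proof. by rewrite eq_sym next_color_neq. Qed.

Lemma flexible_eq x : (forall w, anc 2 w = Some x -> repair w = old w) ->
  flexible old x -> flexible repair x.
Proof.
move=> eqw /flexibleP flx; apply/flexibleP => w w' wx w'x.
by rewrite !eqw //; apply: flx.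
Qed.

Lemma flexible_const c x : (forall w, anc 2 w = Some x -> repair w = c) -> flexible repair x.
Proof. by move=> eqc; apply/flexibleP => w w' /eqc -> /eqc ->. Qed.

Lemma flexible_deep k x : anc k x = Some a -> 9 < k ->
  flexible old x -> flexible repair x.
Proof.
move=> xa k9; apply: flexible_eq => w wx.
by apply: (@repair_deep (k + 2)); [rewrite (anc_add _ wx) | lia].
Qed.

Lemma flexible_top k x : anc k x = Some a -> k <= 5 -> flexible repair x.
Proof.
move=> xa k5; apply: flexible_const => w wx.
apply: (@repair_top (k + 2)); [by rewrite (anc_add _ wx) | | lia].
by apply/orP; right; lia.
Qed.

Lemma flexible7 s : anc 7 s = Some a -> flexible repair s.
Proof. by move=> sa; apply: flexible_const => w ws; apply: repair9 ws. Qed.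

(** A path from inside the subtree of [a] up to [u] outside leaves through [a]; so [a] is not the
    root, and [keep] holds. *)
Lemma above_top u j k w : keep || (rpar G a == None) -> (forall i, anc i u <> Some a) ->
  anc j w = Some u -> anc k w = Some a -> k < j /\ keep.
Proof.
move=> ka ua wu wa.
have kj : k < j.
  rewrite ltnNge; apply/negP => jk; apply: (ua (k - j)).
  by rewrite -(anc_add (k - j) wu) subnK.
split=> //; case/orP: ka => // /eqP a0.
by move: wu; rewrite -(subnK kj) addnS -addSn (anc_add _ wa) anc_root.
Qed.

Lemma repair_flex_outside u :
  keep || (rpar G a == None) -> (forall k, anc k u <> Some a) ->
  flex_verifier old u -> flex_verifier repair u.
Proof.
move=> ka ua /andP [/proper_atP pu fu].
have same j w : j <= 2 -> anc j w = Some u -> repair w = old w.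
  move=> j2 wu; case: (boolP [exists k : 'I_2, anc k w == Some a]) => [/existsP [k /eqP wa]|].
    have [_ kp] := above_top ka ua wu wa.
    by apply: repair_keep wa kp _; rewrite -ltnS.
  move=> /existsPn nwa; apply: repair_outside => k wa.
  have [kj _] := above_top ka ua wu wa.
  by have := nwa (Ordinal (leq_trans kj j2)); rewrite wa eqxx.
apply/andP; split.
  by apply/proper_atP => w wu; rewrite (same 0) ?(same 1 w) ?(ancS _ wu) //; apply: pu.
case/orP: fu => [fu|/kids_flexibleP fu]; apply/orP; [left|right].
  by apply: flexible_eq fu => w /same; apply.
apply/kids_flexibleP => q qu.
(* Great-grandchildren of [u] reach a recolored level only if [q = a], and then [a] is flexible
   because its grandchildren all get [even_color]. *)
have [qa|qa] := eqVneq q a; first by apply: (@flexible_top 0); rewrite ?qa.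
apply: flexible_eq (fu q qu) => w wq.
have wu : anc 3 w = Some u by rewrite (anc_add 1 wq) (ancS _ qu).
case: (boolP [exists k : 'I_2, anc k w == Some a]) => [/existsP [k /eqP wa]|].
  have [_ kp] := above_top ka ua wu wa.
  by apply: repair_keep wa kp _; rewrite -ltnS.
move=> /existsPn nwa; apply: repair_outside => k wa.
have [k3 _] := above_top ka ua wu wa.
case: (ltnP k 2) => k2; first by have := nwa (Ordinal k2); rewrite wa eqxx.
have kE : k = 2 by lia.
by move: wa; rewrite kE wq => -[/eqP]; rewrite (negbTE qa).
Qed.

Lemma proper_top k u : anc k u = Some a -> ~~ keep || (0 < k) -> k <= 6 -> proper_at repair u.
Proof.
move=> ua kk k6; apply/proper_atP => w wu.
have wa : anc k.+1 w = Some a by rewrite (ancS _ wu).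
rewrite (repair_top wa); [|by case/orP: kk => [->|kk] //; apply/orP; right|lia].
have [k1|k1] := boolP (~~ keep || (1 < k)).
  rewrite (repair_top ua) //; last lia.
  by rewrite /=; case: (odd k); rewrite /= ?even_odd_color // eq_sym even_odd_color.
move: k1; rewrite negb_or negbK -leqNgt => /andP [kp k1].
have kE : k = 1 by rewrite kp /= in kk; lia.
rewrite kE in ua *; rewrite (repair_keep ua) //= eq_sym; apply: kids_avoidP.
by move: ua; rewrite /anc.
Qed.

(** Near the filled hole only the new colors can be relied on: levels up to 5 have uniform
    grandchildren, level 7 is flexible by [target], and level 6 is satisfied through its
    children. *)
Lemma repair_flex_top k u : anc k u = Some a -> ~~ keep || (0 < k) -> k <= 7 ->
  flex_verifier repair u.
Proof.
move=> ua kk k7; have [k6|k6] := leqP k 6.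
  apply/andP; split; first exact: proper_top ua kk k6.
  have [k5|k5] := leqP k 5; first by rewrite (flexible_top ua).
  have kE : k = 6 by lia.
  apply/orP; right; apply/kids_flexibleP => s su; apply: flexible7.
  by rewrite (ancS _ su) -kE.
have kE : k = 7 by lia.
rewrite kE in ua; rewrite /flex_verifier flexible7 // andbT; apply/proper_atP => q qu.
by rewrite (repair8 ua qu) (repair_top ua) ?orbT // eq_sym avoid1.
Qed.

Lemma repair_flex_keep u : anc 0 u = Some a -> keep ->
  flex_verifier old u -> flex_verifier repair u.
Proof.
move=> ua kp /andP [/proper_atP pu _]; rewrite /flex_verifier (flexible_top ua) // andbT.
apply/proper_atP => w wu; rewrite (repair_keep ua) // (@repair_keep 1) ?(ancS _ wu) //.
exact: pu.
Qed.

(** * Gluing the new levels to the old coloring underneath *)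

Section Bottom.
Variables (s q : rV G).
Hypothesis sa : anc 7 s = Some a.
Hypothesis qs : rpar G q = Some s.

Let flexible_below k x : anc k x = Some q -> 1 < k -> flexible old x -> flexible repair x.
Proof.
move=> xq k2; apply: (@flexible_deep (8 + k)); last lia.
by rewrite (anc_add 8 xq) (ancS _ qs).
Qed.

Let kids_flexible_below k x : anc k x = Some q -> 0 < k ->
  kids_flexible old x -> kids_flexible repair x.
Proof.
move=> xq k0 /kids_flexibleP H; apply/kids_flexibleP => y yx.
by apply: (@flexible_below k.+1); [rewrite (ancS _ yx) | | apply: H].
Qed.

Lemma target_grandkid : target s != grandkid_color q.
Proof. exact: kids_avoidP. Qed.

Lemma flexible_kid z : rpar G z = Some q -> flexible old q || flexible old z ->
  flexible old z -> flexible repair z.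
Proof.
move=> zq fqz; apply: flexible_eq => w /eqP/anc2P [y wy yz].
by rewrite (repair11 sa qs zq yz wy) fqz.
Qed.

(** If [q] was flexible, its grandchildren resume their old colors; otherwise all its children were
    flexible and remain so. *)
Lemma repair_flex8 : flex_verifier old q -> flex_verifier repair q.
Proof.
move=> /andP [_ fq]; apply/andP; split.
  apply/proper_atP => z zq.
  by rewrite (repair8 sa qs) (repair9 sa (anc2 zq qs)) avoid2.
have [flq0|flq] := boolP (flexible old q).
  apply/orP; left; apply: (flexible_eq _ flq0) => y /eqP/anc2P [z yz zq].
  by rewrite (repair10 sa qs zq yz) flq0.
move: fq; rewrite (negbTE flq) /= => /kids_flexibleP fq.
apply/orP; right; apply/kids_flexibleP => z zq.
by apply: (flexible_kid zq _ (fq z zq)); rewrite (fq z zq) orbT.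
Qed.

(** Below a flexible [q], a child of [z] resumes the old color [grandkid_color q], which [target s]
    avoids. Otherwise it avoids [target s], since the old verifier holds at [z]. *)
Lemma repair_flex9 z : rpar G z = Some q -> flex_verifier old z -> flex_verifier repair z.
Proof.
move=> zq /andP [_ fz]; apply/andP; split.
  apply/proper_atP => y yz.
  rewrite (repair9 sa (anc2 zq qs)) (repair10 sa qs zq yz).
  case: (boolP (flexible old q)) => [flq|_] /=; last by rewrite fz eq_sym avoid1.
  by rewrite -(grandkid_colorP flq (anc2 yz zq)) target_grandkid.
have [kfz|kfz] := boolP (kids_flexible old z).
  by rewrite (@kids_flexible_below 1) ?orbT ?(ancS _ zq).
move: fz; rewrite (negbTE kfz) orbF => fz.
by rewrite flexible_kid // fz orbT.
Qed.

(** If [q] was flexible, or neither alternative held at [z], both ends keep their old colors.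
    Otherwise, if [z] was flexible, [y] avoids the old color of [x]; if only its children were, [x]
    avoids the new color of [y]. *)
Lemma repair_flex10 z y : rpar G z = Some q -> rpar G y = Some z ->
  flex_verifier old y -> flex_verifier repair y.
Proof.
move=> zq yz /andP [/proper_atP py fy]; apply/andP; split.
  apply/proper_atP => x xy.
  rewrite (repair10 sa qs zq yz) (repair11 sa qs zq yz xy).
  case: (boolP (flexible old q)) => [flq|_] /=; first exact: py.
  case: (boolP (flexible old z)) => [flz|_] /=.
    by rewrite -(grandkid_colorP flz (anc2 xy yz)) avoid2.
  by case: (boolP (kids_flexible old z)) => _ /=; [rewrite eq_sym avoid1 | apply: py].
have yq : anc 2 y = Some q := anc2 yz zq.
by case/orP: fy => fy; [rewrite (flexible_below yq) | rewrite (kids_flexible_below yq) ?orbT].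
Qed.

(** If [x] is newly colored, its parent [y] was flexible, so the children of [x] have the color
    [grandkid_color y], which [x] avoids. *)
Lemma repair_flex11 z y x : rpar G z = Some q -> rpar G y = Some z -> rpar G x = Some y ->
  flex_verifier old x -> flex_verifier repair x.
Proof.
move=> zq yz xy /andP [/proper_atP px fx].
have xq : anc 3 x = Some q by rewrite (ancS _ xy) (ancS _ yz) (ancS _ zq).
apply/andP; split; last first.
  by case/orP: fx => fx; [rewrite (flexible_below xq) | rewrite (kids_flexible_below xq) ?orbT].
apply/proper_atP => w wx.
rewrite (@repair_deep 12 w) //; last by rewrite (ancS _ wx) (anc_add 8 xq) (ancS _ qs).
rewrite (repair11 sa qs zq yz xy); case: ifP => [_|]; first exact: px.
move=> /negbT; rewrite !negb_or negbK => /andP [_ /kids_flexibleP /(_ y yz) fly].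
by rewrite -(grandkid_colorP fly (anc2 wx xy)) avoid2.
Qed.

Lemma repair_flex12 k x : anc k x = Some q -> 3 < k ->
  flex_verifier old x -> flex_verifier repair x.
Proof.
move=> xq k3 /andP [/proper_atP px fx].
have xa : anc (8 + k) x = Some a by rewrite (anc_add 8 xq) (ancS _ qs).
apply/andP; split; last first.
  case/orP: fx => fx; first by rewrite (flexible_below xq) //; lia.
  by rewrite (kids_flexible_below xq) ?orbT //; lia.
apply/proper_atP => w wx.
rewrite (repair_deep xa) ?(@repair_deep (8 + k).+1 w) ?(ancS _ wx) //; try lia.
exact: px.
Qed.

End Bottom.

Lemma repair_flex u : keep || (rpar G a == None) ->
  flex_verifier old u \/ (exists k, [/\ anc k u = Some a, ~~ keep || (0 < k) & k <= 7]) ->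
  flex_verifier repair u.
Proof.
move=> ka [fu|[k [ua kk k7]]]; last exact: repair_flex_top ua kk k7.
have [/eqP ua|ua] := boolP (anc (depth u - depth a) u == Some a); last first.
  apply: repair_flex_outside => // k E; move: ua; rewrite (depth_anc E) addKn E eqxx //.
move: (_ - _) ua => k ua.
case: (boolP (~~ keep || (0 < k))) => [kk|]; last first.
  rewrite negb_or negbK -leqNgt leqn0 => /andP [kp /eqP k0].
  by rewrite k0 in ua; apply: repair_flex_keep.
have [k7|k7] := leqP k 7; first exact: repair_flex_top ua kk k7.
(* From level 8 on, the ancestor [q] at level 8 is fixed, and the distance [k - 8] to it selects the
   case. *)
have [q uq] : exists q, anc (k - 8) u = Some q.
  by apply: anc_depth; rewrite (depth_anc ua); lia.
have qa : anc 8 q = Some a by rewrite -(anc_add 8 uq) subnKC.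
have [s qs] : exists s, rpar G q = Some s.
  by move: qa; rewrite /anc iterSr /=; case: (rpar G q) => [s|] // _; exists s.
have sa : anc 7 s = Some a by rewrite -(ancS _ qs).
move: (k - 8) uq => j uq.
have [j3|j3] := ltnP 3 j; first exact: (repair_flex12 sa qs uq j3 fu).
case: j j3 uq => [_ [uq]|j j3]; first by rewrite uq in fu *; apply: repair_flex8 sa qs fu.
have par1 x y i : anc i.+1 x = Some y -> exists2 z, rpar G x = Some z & anc i z = Some y.
  case xz: (rpar G x) => [z|]; first by rewrite (ancS _ xz) => zy; exists z.
  by rewrite anc_root.
case/par1=> z uz; case: j j3 => [_ [zq]|j j3].
  by apply: (repair_flex9 sa qs _ fu); rewrite uz zq.
case/par1=> z1 zz1; case: j j3 => [_ [zq]|j j3].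
  by apply: (repair_flex10 sa qs _ uz fu); rewrite zz1 zq.
case/par1=> z2 zz2; case: j j3 => [_ [zq]|//].
by apply: (repair_flex11 sa qs _ zz1 uz fu); rewrite zz2 zq.
Qed.

End Repair.

(** * Mending a single hole *)

Lemma mend_top G (v : rV G) : exists (a : rV G) k (keep : bool),
  [/\ anc k v = Some a, k <= 4, keep || (rpar G a == None) & keep -> k = 4].
Proof.
(* Four levels up, every node within distance 3 of [v] is strictly below [a], hence away from the
   kept color of [a]. *)
have [v4|v4] := leqP 4 (depth v).
  by have [a va] := anc_depth v4; exists a, 4, true.
have [a va] := anc_depth (leqnn (depth v)); exists a, (depth v), false; split=> //; first lia.
case ap: (rpar G a) => [p|] //.
by have := depth_anc va; rewrite (depth_par ap); lia.
Qed.

Lemma flex_coloring_mendable : O1_mendable color flex_coloring.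
Proof.
(* 15 = 4 + 11: [v] is at most 4 levels below [a], and levels beyond 11 are unchanged. *)
exists 3, (fun G l v => flex_verifier l v), 15; split; first exact: flex_coloring_verifier_for.
move=> G lam /flex_accepted acc v.
have [lv|lv] := eqVneq (lam v) None; last first.
  by exists lam; split=> //; [apply/flex_accepted | move=> u /eqP].
have [a [k [keep [va k4 ka kk]]]] := mend_top v.
pose old u := odflt ord0 (lam u).
(* Holes other than [v] stay holes, so the nodes that see one remain happy. *)
pose mu u := if (lam u == None) && (u != v) then None else Some (repair old a keep u).
exists mu; split.
- apply/flex_accepted => u.
  case: (boolP [exists w in ball G 3 u, mu w == None]) => [/existsP [w /andP [wu /eqP w0]]|].
    by left; exists w.
  move=> /existsPn nex; right.
  have mu_some w : w \in ball G 3 u -> ~~ ((lam w == None) && (w != v)).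
    by move=> wu; have := nex w; rewrite wu /mu; case: ifP.
  rewrite (@flex_verifier_eq_in _ _ mu (repair old a keep)); last first.
    by move=> w /mu_some /negbTE E; rewrite /mu E.
  apply: repair_flex => //.
  (* Nodes that see [v] lie at level at most 4 + 3 = 7 below [a]. The others, seeing no hole, were
     already satisfied by the old coloring. *)
  have [vu|vu] := boolP (v \in ball G 3 u).
    right; have [z [i [j [ij uz vz]]]] := ball_anc vu.
    have jk : j <= k.
      case/orP: ka => [/kk kE|/eqP a0]; first lia.
      by have := depth_anc va; rewrite (depth_anc vz) (depth_root a0); lia.
    have za : anc (k - j) z = Some a by rewrite -(anc_add _ vz) subnK.
    exists (k - j + i); split; first by rewrite (anc_add _ uz).
      by case: (keep) kk => //= /(_ isT); lia.
    lia.
  left; have lam_some w : w \in ball G 3 u -> lam w = Some (old w).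
    move=> wu; have := mu_some w wu; have -> : w != v by apply: contraNneq vu => <-.
    by rewrite andbT /old; case: (lam w).
  case: (acc u) => [[w wu w0]|]; first by have := lam_some w wu; rewrite w0.
  by rewrite (flex_verifier_eq_in lam_some).
- by rewrite /mu eqxx andbF.
- by move=> u; rewrite /mu; case: ifP => // /andP [/eqP].
move=> u neq.
have [/existsP [i /eqP ua]|/existsPn nua] := boolP [exists i : 'I_12, anc i u == Some a].
  have [av _] := anc_ball va; have [_ ua'] := anc_ball ua.
  by apply: ball_leq (ball_trans av ua'); have := ltn_ord i; lia.
exfalso; move: neq; rewrite /mu.
have far i : anc i u = Some a -> 11 < i.
  move=> ua; rewrite ltnNge; apply/negP => i11.
  by have := nua (Ordinal (i11 : i < 12)); rewrite ua eqxx.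
have -> : u != v by apply/eqP => uv; have := far k; rewrite uv => /(_ va); lia.
have -> : repair old a keep u = old u.
  have [/eqP ua|nu] := boolP (anc (depth u - depth a) u == Some a).
    exact: repair_deep ua (far _ ua).
  by apply: repair_outside => i E; move: nu; rewrite (depth_anc E) addKn E eqxx.
by rewrite andbT /old; case: (lam u) => [c|] //=; rewrite eqxx.
Qed.

Theorem theorem7p3 :
  exists P' : problem color,
    [/\ is_LCL color P',
        forall c, 1 <= c -> same_asymptotic_complexity color color c three_coloring P',
        forall G (l : rV G -> color), P' G l -> three_coloring G l
      & O1_mendable color P'].
Proof.
exists flex_coloring; split.
- by do 2!eexists; apply: flex_coloring_verifier_for.
- exact: flex_coloring_complexity.
- exact: flex_coloring_proper.
- exact: flex_coloring_mendable.
Qed.
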